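(* The word problem of $\mathbb Z^n$ is indexed for all $n\ge 1$ if and only if every counter language is indexed.
   Context: Word problem: for a group $G$ with finite generating set $\mathcal G$, the word problem is the set of words $w\in\mathcal G^*$ that represent the identity element of $G$; it is a language over the finite alphabet $\mathcal G$. Here $\mathcal G$ generates $G$ as a monoid (for $\mathbb Z^n$, for instance, the standard generators together with their inverses). $G$-automaton: let $G$ be a group and $\Sigma$ a finite set, and write $\Sigma^{\pm1}$ for the letters of $\Sigma$ together with their formal inverses. A (non-deterministic) $G$-automaton $A_G$ over $\Sigma$ is a finite directed graph with a distinguished start vertex $q_0$, some distinguished accept vertices, and edges labeled by elements of $(\Sigma^{\pm1}\cup\{\epsilon\})\times G$, where $\epsilon$ is the empty word. For a directed path $p$ in $A_G$, $w(p)\in(\Sigma^{\pm1})^*$ is the concatenation of the first components of its edge labels, and $g(p)\in G$ is the product, in order, of the second components; for the empty path, $w(p)$ is the empty word and $g(p)$ is the identity. The automaton accepts a word $w\in(\Sigma^{\pm1})^*$ if there is a path $p$ from $q_0$ to some accept vertex with $w(p)=w$ and $g(p)$ equal to the identity of $G$. The language of $A_G$ is the set of words it accepts. Counter language: a language is $k$-counter if it is accepted by some $\mathbb Z^k$-automaton, and it is counter if it is $k$-counter for some $k\ge1$. Indexed: a language is indexed if it is accepted by a (one-way, non-deterministic) nested stack automaton; equivalently, if it is generated by an indexed grammar in the sense of Aho. *)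

(* Defs.v *)
From Stdlib Require Import Relation_Operators.
From HB Require Import structures.
From mathcomp Require Import all_boot all_order all_algebra finmap.

Set Implicit Arguments.
Unset Strict Implicit.
Unset Printing Implicit Defensive.

Local Open Scope group_scope.

Definition language (T : Type) := seq T -> Prop.

(* [to_multiplicative] turns the additive group of row vectors into a
   [groupType]: its product is vector addition and its unit the zero vector. *)
Definition Zn (n : nat) : groupType := Algebra.to_multiplicative 'rV[int]_n.

Section WordProblem.
Variables (G : groupType) (S : {fset G}).

Definition word_value (w : seq S) : G := \prod_(x <- w) fsval x.

Definition generates_as_monoid := forall g : G, exists w : seq S, word_value w = g.

Definition word_problem : language S := fun w => word_value w = 1.

End WordProblem.

(* [inl x] is the letter [x], [inr x] its formal inverse; words over these
   letters are not reduced. *)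
Definition signed (Sigma : finType) : finType := (Sigma + Sigma)%type.

(* The label component [None] is the empty word. *)
Record automaton (Sigma : finType) (G : groupType) := Automaton {
  vertex : finType;
  edges  : seq (vertex * (option (signed Sigma) * G) * vertex);
  start  : vertex;
  accept : {set vertex}
}.

Section Acceptance.
Variables (Sigma : finType) (G : groupType) (A : automaton Sigma G).

Notation edge := (vertex A * (option (signed Sigma) * G) * vertex A)%type.

Fixpoint is_path (q : vertex A) (p : seq edge) (q' : vertex A) : bool :=
  if p is e :: p' then [&& e \in edges A, e.1.1 == q & is_path e.2 p' q']
  else q == q'.

Definition path_word (p : seq edge) : seq (signed Sigma) :=
  pmap (fun e : edge => e.1.2.1) p.

Definition path_value (p : seq edge) : G := \prod_(e <- p) e.1.2.2.

Definition accepted : language (signed Sigma) := fun w =>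
  exists p : seq edge, exists2 q, q \in accept A &
    [/\ is_path (start A) p q, path_word p = w & path_value p = 1].

End Acceptance.

Definition k_counter (k : nat) (Sigma : finType) (L : language (signed Sigma)) :=
  exists A : automaton Sigma (Zn k), forall w, L w <-> accepted A w.

Definition counter (Sigma : finType) (L : language (signed Sigma)) :=
  exists2 k, 1 <= k & k_counter k L.

(* Aho's indexed grammars.  In the right-hand side of a production, a
   nonterminal carries the string of indices to be pushed; the productions
   [iprods f] belonging to the index [f] carry none. *)
Record indexed_grammar (T : finType) := IndexedGrammar {
  nonterm      : finType;
  index_symbol : finType;
  prods        : seq (nonterm * seq (T + nonterm * seq index_symbol));
  iprods       : index_symbol -> seq (nonterm * seq (T + nonterm));
  start_symbol : nonterm
}.

Section Derivation.
Variables (T : finType) (G : indexed_grammar T).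

Notation symbol := (T + nonterm G * seq (index_symbol G))%type.

(* Indices are inherited by every nonterminal of a right-hand side and dropped
   at its terminals. *)
Definition inherit (z : seq (index_symbol G)) (x : symbol) : symbol :=
  match x with inl a => inl a | inr (X, eta) => inr (X, eta ++ z) end.

Definition inherit_bare (z : seq (index_symbol G)) (x : T + nonterm G) : symbol :=
  match x with inl a => inl a | inr X => inr (X, z) end.

Inductive step : seq symbol -> seq symbol -> Prop :=
| step_prod u v X z rhs : (X, rhs) \in prods G ->
    step (u ++ inr (X, z) :: v) (u ++ map (inherit z) rhs ++ v)
| step_index u v X f z rhs : (X, rhs) \in iprods f ->
    step (u ++ inr (X, f :: z) :: v) (u ++ map (inherit_bare z) rhs ++ v).

Definition generated : language T := fun w =>
  clos_refl_trans _ step [:: inr (start_symbol G, [::])] (map inl w).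

End Derivation.

Definition indexed (T : finType) (L : language T) :=
  exists G : indexed_grammar T, forall w, L w <-> generated G w.

(* Main.v *)
(** Both directions rest on the closure of indexed languages under finite-state
    transductions, proved by the triple construction: a nonterminal [(q, X, q')]
    derives the outputs of the transducer running from [q] to [q'] over the words
    derived from [X].  A [G]-automaton is a transducer applied to the word problem
    of [G] once each group label is spelled as a word in the generators, and the
    word problem is itself the language of a one-vertex automaton. *)

Require Import Defs.
From Stdlib Require Import Relation_Operators Operators_Properties.
From mathcomp Require Import all_boot all_order all_algebra finmap.

Set Implicit Arguments.
Unset Strict Implicit.
Unset Printing Implicit Defensive.

(** * Finite-state transducers and their lifting to sentential forms *)

Record transducer (S T : finType) := Transducer {
  state : finType;
  moves : state -> S -> seq (seq T * state);
  initial : state;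
  final : {set state}
}.

Section Transduction.
Variables (S T : finType) (M : transducer S T).
Notation Q := (state M).

(** Every move consumes exactly one letter, so the recursion is on the input; moves on the empty
    word do not exist, which later forces nonempty spellings. *)
Fixpoint transduces (u : seq S) (q : Q) (w : seq T) (q' : Q) : Prop :=
  if u is s :: u' then
    exists m w', [/\ m \in moves q s, transduces u' m.2 w' q' & w = m.1 ++ w']
  else q = q' /\ w = [::].

Definition transduction (L : language S) : language T := fun w =>
  exists2 u, L u & exists2 q, q \in final M & transduces u (initial M) w q.

(* Transduction of a form with variables in [Y], where a variable [y] may move
   the transducer from any [q] to any [q'] and is then renamed [h q y q']. *)
Fixpoint lifts (Y Z : Type) (h : Q -> Y -> Q -> Z)
    (a : seq (S + Y)) (q : Q) (b : seq (T + Z)) (q' : Q) : Prop :=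
  match a with
  | [::] => q = q' /\ b = [::]
  | inl s :: a' => exists m b',
      [/\ m \in moves q s, lifts h a' m.2 b' q' & b = map inl m.1 ++ b']
  | inr y :: a' => exists q1 b', lifts h a' q1 b' q' /\ b = inr (h q y q1) :: b'
  end.

Lemma lifts_cat (Y Z : Type) (h : Q -> Y -> Q -> Z) a1 a2 q b q' :
  lifts h (a1 ++ a2) q b q' <->
  exists q1 b1 b2, [/\ lifts h a1 q b1 q1, lifts h a2 q1 b2 q' & b = b1 ++ b2].
Proof.
elim: a1 q b => [|[s|y] a1 IH] q b /=; split.
- by move=> H; exists q, [::], b.
- by case=> q1 [b1 [b2 [[-> ->] H ->]]].
- case=> m [b' [Hm /IH [q1 [b1 [b2 [H1 H2 ->]]]] ->]].
  exists q1, (map inl m.1 ++ b1), b2; split; rewrite ?catA //.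
  by exists m, b1.
- case=> q1 [_ [b2 [[m [b' [Hm H1 ->]]] H2 ->]]].
  exists m, (b' ++ b2); split; rewrite ?catA //.
  by apply/IH; exists q1, b', b2.
- case=> q2 [b' [/IH [q1 [b1 [b2 [H1 H2 ->]]]] ->]].
  by exists q1, (inr (h q y q2) :: b1), b2; split=> //; exists q2, b1.
- case=> q1 [_ [b2 [[q2 [b' [H1 ->]]] H2 ->]]].
  by exists q2, (b' ++ b2); split=> //; apply/IH; exists q1, b', b2.
Qed.

(** Moves write terminals only, so a variable of the output can only be the renaming of a variable
    of the input; cutting there locates what a derivation step rewrites. *)
Lemma lifts_split_var (Y Z : Type) (h : Q -> Y -> Q -> Z) a q b1 z b2 q' :
  lifts h a q (b1 ++ inr z :: b2) q' ->
  exists a1 y a2 q1 q2, [/\ a = a1 ++ inr y :: a2, z = h q1 y q2,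
    lifts h a1 q b1 q1 & lifts h a2 q2 b2 q'].
Proof.
have inl_prefix (l : seq T) (b' c1 : seq (T + Z)) :
    c1 ++ inr z :: b2 = map inl l ++ b' ->
    exists2 c, c1 = map inl l ++ c & b' = c ++ inr z :: b2.
  elim: l c1 => [|x l IHl] [|y c1] //=.
  - by move=> <-; exists [::].
  - by move=> <-; exists (y :: c1).
  - by case=> -> /IHl [c -> ->]; exists c.
elim: a q b1 => [|[s|y] a IH] q b1 /=.
- by case: b1 => [|? ?] [].
- case=> m [b' [Hm Ha]] /inl_prefix [c -> Eb']; rewrite {}Eb' in Ha.
  have [a1 [y [a2 [q1 [q2 [-> -> H1 H2]]]]]] := IH _ _ Ha.
  by exists (inl s :: a1), y, a2, q1, q2; split=> //; exists m, c.
- case=> q1 [b' [Ha]]; case: b1 => [|x b1] /= [Ex Eb'].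
    by exists [::], y, a, q, q1; split=> //; rewrite Eb'.
  rewrite -{}Eb' in Ha.
  have [a1 [y' [a2 [p1 [p2 [-> -> H1 H2]]]]]] := IH _ _ Ha.
  exists (inr y :: a1), y', a2, p1, p2; split=> //=.
  by exists q1, b1; rewrite Ex.
Qed.

Definition map_var (X Y Z : Type) (f : Y -> Z) (x : X + Y) : X + Z :=
  match x with inl a => inl a | inr y => inr (f y) end.

(** Naturality: a renaming of variables that does not interfere with the states commutes with
    lifting. Attaching an inherited index string is such a renaming. *)
Lemma lifts_map (Y Y' Z Z' : Type) (h : Q -> Y -> Q -> Z)
    (h' : Q -> Y' -> Q -> Z') (f : Y -> Y') (g : Z -> Z') a q b q' :
  (forall q1 y q2, h' q1 (f y) q2 = g (h q1 y q2)) ->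
  lifts h' (map (map_var f) a) q b q' <->
  exists2 b0, lifts h a q b0 q' & b = map (map_var g) b0.
Proof.
move=> hfg.
have mapinl (l : seq T) : map (map_var g) (map inl l) = map inl l.
  by rewrite -map_comp; apply: eq_map.
elim: a q b => [|[s|y] a IH] q b /=; split.
- by case=> -> ->; exists [::].
- by case=> b0 [-> ->] ->.
- case=> m [b' [Hm /IH [b0 H0 ->] ->]].
  exists (map inl m.1 ++ b0); first by exists m, b0.
  by rewrite map_cat mapinl.
- case=> _ [m [b0 [Hm H0 ->]]] ->; exists m, (map (map_var g) b0).
  by rewrite map_cat mapinl; split=> //; apply/IH; exists b0.
- case=> q1 [b' [/IH [b0 H0 ->] ->]].
  exists (inr (h q y q1) :: b0); first by exists q1, b0.
  by rewrite /= hfg.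
- case=> _ [q1 [b0 [H0 ->]]] ->; exists q1, (map (map_var g) b0).
  by rewrite /= hfg; split=> //; apply/IH; exists b0.
Qed.

(** Each input variable leaves a variable in the output, so a form with a terminal lift is itself
    terminal. *)
Lemma lifts_words (Y Z : Type) (h : Q -> Y -> Q -> Z) a q w q' :
  lifts h a q (map inl w) q' <->
  exists2 u, a = map inl u & transduces u q w q'.
Proof.
have inl_prefix (l v : seq T) (b : seq (T + Z)) :
    map inl v = map inl l ++ b -> exists2 v', v = l ++ v' & b = map inl v'.
  elim: l v => [|x l IHl] [|y v] //=.
  - by move=> <-; exists [::].
  - by move=> <-; exists (y :: v).
  - by case=> -> /IHl [v' -> ->]; exists v'.
elim: a q w => [|[s|y] a IH] q w /=; split.
- by case=> ->; case: w => // _; exists [::].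
- by case=> -[|? ?] //= _ [-> ->].
- case=> m [b [Hm Ha]] /inl_prefix [w' -> Eb].
  move: Ha; rewrite Eb => /IH [u -> Hu].
  by exists (s :: u) => //; exists m, w'.
- case=> -[|_ u] //= [<- Ea] [m [w' [Hm Hu ->]]].
  exists m, (map inl w'); rewrite map_cat; split=> //.
  by apply/IH; exists u.
- by case=> q1 [b [_]]; case: w.
- by case=> -[].
Qed.

(** Enumerates the relation [lifts] for a fixed form: a grammar needs a finite list of productions,
    one for each lift of a right-hand side. *)
Fixpoint lift_seq (Y Z : Type) (h : Q -> Y -> Q -> Z) (a : seq (S + Y)) :
    seq (Q * seq (T + Z) * Q) :=
  match a with
  | [::] => [seq (q, [::], q) | q <- enum Q]
  | inl s :: a' =>
      [seq (qm.1, map inl qm.2.1 ++ t.1.2, t.2)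
         | qm <- [seq (q, m) | q <- enum Q, m <- moves q s],
           t <- [seq t <- lift_seq h a' | t.1.1 == qm.2.2]]
  | inr y :: a' =>
      [seq (q, inr (h q y t.1.1) :: t.1.2, t.2)
         | q <- enum Q, t <- lift_seq h a']
  end.

Lemma lift_seqP (Y : Type) (Z : eqType) (h : Q -> Y -> Q -> Z) a q b q' :
  (q, b, q') \in lift_seq h a <-> lifts h a q b q'.
Proof.
elim: a q b q' => [|[s|y] a IH] q b q' /=; split.
- by case/mapP=> p _ [-> -> ->].
- by case=> <- ->; apply/mapP; exists q => //; rewrite mem_enum.
- case/allpairsPdep=> -[p m] [[[p1 b1] p2]] [/allpairsPdep [p' [m' [_ Hm]]]].
  case=> ? ?; subst p' m'; rewrite mem_filter /= => /andP [/eqP Ep /IH H].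
  by case=> -> -> ->; exists m, b1; rewrite -Ep.
- case=> m [b1 [Hm /IH H ->]]; apply/allpairsPdep.
  exists (q, m), (m.2, b1, q'); split=> //.
    by apply/allpairsPdep; exists q, m; rewrite mem_enum.
  by rewrite mem_filter eqxx.
- case/allpairsP=> -[p [[p1 b1] p2]] /= [_ /IH H [-> -> ->]].
  by exists p1, b1.
- case=> q1 [b1 [/IH H ->]]; apply/allpairsP.
  by exists (q, (q1, b1, q')); rewrite mem_enum.
Qed.

(** * The triple construction for indexed grammars *)

Section Grammar.
Variable G : indexed_grammar S.
Notation N := (nonterm G).
Notation I := (index_symbol G).

(* [None] is a fresh start symbol, which guesses the final state. *)
Definition triple (q : Q) (X : N) (q' : Q) : option (Q * N * Q) :=
  Some (q, X, q').

(** States decorate the nonterminal alone; the index string is kept, so both grammars manipulate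
    their indices in the same way. *)
Definition triple_indexed (q : Q) (y : N * seq I) (q' : Q) :
    option (Q * N * Q) * seq I := (triple q y.1 q', y.2).

Definition transduction_grammar : indexed_grammar T :=
  @IndexedGrammar T (option (Q * N * Q)) I
    ([seq (None, [:: inr (triple (initial M) (start_symbol G) q, [::])])
        | q <- enum (final M)] ++
     [seq (triple t.1.1 r.1 t.2, t.1.2)
        | r <- prods G, t <- lift_seq triple_indexed r.2])
    (fun f => [seq (triple t.1.1 r.1 t.2, t.1.2)
        | r <- iprods f, t <- lift_seq triple r.2])
    None.

Lemma lifts_inherit (z : seq I) rhs q b q' :
  lifts triple_indexed (map (inherit z) rhs) q b q' <->
  exists2 b0, lifts triple_indexed rhs q b0 q' &
    b = map (@inherit _ transduction_grammar z) b0.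
Proof.
pose push (X : finType) (y : X * seq I) := (y.1, y.2 ++ z).
have E1 : inherit z =1 map_var (push N) by case=> [|[]].
have E2 : @inherit _ transduction_grammar z
            =1 map_var (push (option (Q * N * Q))%type) by case=> [|[]].
rewrite (eq_map E1) (lifts_map (h := triple_indexed)
  (g := push (option (Q * N * Q))%type)) //.
by split=> -[b0 H ->]; exists b0; rewrite // (eq_map E2).
Qed.

Lemma lifts_inherit_bare (z : seq I) rhs q b q' :
  lifts triple_indexed (map (inherit_bare z) rhs) q b q' <->
  exists2 b0, lifts triple rhs q b0 q' &
    b = map (@inherit_bare _ transduction_grammar z) b0.
Proof.
pose push (X : finType) (y : X) := (y, z).
have E1 : inherit_bare z =1 map_var (push N) by case.
rewrite (eq_map E1) (lifts_map (h := triple)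
  (g := push (option (Q * N * Q))%type)) //.
Qed.

(** Steps are lifted backwards: a lift of the result shows the states [q1] and [q2] at the two ends
    of the rewritten right-hand side, and these determine the triple to put before the step. *)
Lemma lifts_step a a' q b' q' :
  step a a' -> lifts triple_indexed a' q b' q' ->
  exists2 b, lifts triple_indexed a q b q' &
    step (b : seq (T + nonterm transduction_grammar * _)) b'.
Proof.
case=> [u v X z rhs Hr | u v X f z rhs Hr] /lifts_cat [q1 [bu [brv [Hu]]]].
- case/lifts_cat=> q2 [br [bv [/lifts_inherit [b0 H0 ->] Hv -> ->]]].
  exists (bu ++ inr (triple q1 X q2, z) :: bv).
    by apply/lifts_cat; exists q1, bu, (inr (triple q1 X q2, z) :: bv);
      split=> //; exists q2, bv.
  apply: (@step_prod _ transduction_grammar).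
  rewrite mem_cat; apply/orP; right; apply/allpairsPdep.
  by exists (X, rhs), (q1, b0, q2); split=> //; apply/lift_seqP.
- case/lifts_cat=> q2 [br [bv [/lifts_inherit_bare [b0 H0 ->] Hv -> ->]]].
  exists (bu ++ inr (triple q1 X q2, f :: z) :: bv).
    by apply/lifts_cat; exists q1, bu, (inr (triple q1 X q2, f :: z) :: bv);
      split=> //; exists q2, bv.
  apply: (@step_index _ transduction_grammar).
  apply/allpairsPdep.
  by exists (X, rhs), (q1, b0, q2); split=> //; apply/lift_seqP.
Qed.

(** The rewritten triple lies over a variable of [a], and its production is a lift of a production
    of [G], which is applied at that variable. *)
Lemma step_lifts a q (b b' : seq (T + nonterm transduction_grammar * _)) q' :
  step b b' -> lifts triple_indexed a q b q' ->
  exists2 a', step a a' & lifts triple_indexed a' q b' q'.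
Proof.
case=> [u v X z rhs Hr | u v X f z rhs Hr] Ha;
  have [a1 [[Y z'] [a2 [q1 [q2 [-> [EX <-] H1 H2]]]]]] := lifts_split_var Ha.
(* The start productions are excluded: they rewrite [None], and a triple is a [Some]. *)
- move: Hr; rewrite EX mem_cat => /orP [/mapP [? _ []] //|].
  case/allpairsPdep=> -[Y' rhs0] [[[p1 b0] p2]] [Hr /lift_seqP /= H0].
  case=> ? ? ? ?; subst Y' p1 p2 rhs.
  exists (a1 ++ map (@inherit _ G z) rhs0 ++ a2); first exact: step_prod.
  apply/lifts_cat; exists q1, u, (map (@inherit _ transduction_grammar z) b0 ++ v).
  split=> //; apply/lifts_cat.
  exists q2, (map (@inherit _ transduction_grammar z) b0), v; split=> //.
  by apply/lifts_inherit; exists b0.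
- move: Hr; rewrite EX => /allpairsPdep [[Y' rhs0] [[[p1 b0] p2]]].
  case=> Hr /lift_seqP /= H0 [? ? ? ?]; subst Y' p1 p2 rhs.
  exists (a1 ++ map (@inherit_bare _ G z) rhs0 ++ a2); first exact: step_index.
  apply/lifts_cat.
  exists q1, u, (map (@inherit_bare _ transduction_grammar z) b0 ++ v).
  split=> //; apply/lifts_cat.
  exists q2, (map (@inherit_bare _ transduction_grammar z) b0), v; split=> //.
  by apply/lifts_inherit_bare; exists b0.
Qed.

Lemma lifts_steps a a' q b' q' :
  clos_refl_trans _ (@step _ G) a a' -> lifts triple_indexed a' q b' q' ->
  exists2 b, lifts triple_indexed a q b q' &
    clos_refl_trans _ (@step _ transduction_grammar) b b'.
Proof.
move=> Hs; elim: (clos_rt_rt1n _ _ _ _ Hs) => {a a' Hs} [a|a a1 a' H _ IH] Hb'.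
  by exists b' => //; apply: rt_refl.
have [b1 H1 S1] := IH Hb'; have [b Hb S0] := lifts_step H H1.
by exists b => //; apply: rt_trans S1; apply: rt_step.
Qed.

Lemma steps_lifts a q b b' q' :
  clos_refl_trans _ (@step _ transduction_grammar) b b' ->
  lifts triple_indexed a q b q' ->
  exists2 a', clos_refl_trans _ (@step _ G) a a' &
    lifts triple_indexed a' q b' q'.
Proof.
move=> Hs; elim: (clos_rt_rt1n _ _ _ _ Hs) a => {b b' Hs} [b|b b1 b' H _ IH] a Hb.
  by exists a => //; apply: rt_refl.
have [a1 S1 H1] := step_lifts H Hb; have [a' S' H'] := IH _ H1.
by exists a' => //; apply: rt_trans S'; apply: rt_step.
Qed.

(** All lifted productions rewrite triples, and the empty index string rules out index steps, so
    only a start production applies. *)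
Lemma step_start b :
  @step _ transduction_grammar [:: inr (None, [::])] b ->
  exists2 q, q \in final M &
    b = [:: inr (triple (initial M) (start_symbol G) q, [::])].
Proof.
move E : [:: _] => c H; case: H E => [u v X z rhs Hr | u v X f z rhs Hr].
- case: u => [|? []] //= [EX Ez Ev]; subst X z v.
  move: Hr; rewrite mem_cat => /orP [/mapP [q Hq [->]]|].
    by exists q; first by rewrite mem_enum in Hq.
  by case/allpairsPdep=> ? [? [_ _ []]].
- by case: u => [|? []].
Qed.

Lemma generated_transduction w :
  generated transduction_grammar w <-> transduction (generated G) w.
Proof.
pose form q : seq (T + nonterm transduction_grammar * seq I) :=
  [:: inr (triple (initial M) (start_symbol G) q, [::])].
have lifts_form q : lifts triple_indexed [:: inr (start_symbol G, [::])]
    (initial M) (form q) q by exists q, [::].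
split.
- rewrite /generated /=; set b0 := [:: _]; set b' := map _ _ => H.
  have [b /step_start [q Hq ->] Hb] : exists2 b,
      @step _ transduction_grammar b0 b &
      clos_refl_trans _ (@step _ transduction_grammar) b b'.
    (* A terminal word differs from the start form, so the derivation has a first step. *)
    have E : b' <> b0 by rewrite /b' /b0; case: (w).
    case: (clos_rt_rt1n _ _ _ _ H) E => // b c Hb Hc _.
    by exists b => //; apply: clos_rt1n_rt.
  have [a Sa /lifts_words [u Ea Hu]] := steps_lifts Hb (lifts_form q).
  by exists u; [rewrite /generated -Ea | exists q].
- case=> u Gu [q Hq Hu].
  have Hw : lifts triple_indexed (map inl u) (initial M) (map inl w) q.
    by apply/lifts_words; exists u.
  have [b Hb Sb] := lifts_steps Gu Hw.
  case: Hb => q1 [_ [[-> ->] Eb]]; rewrite Eb in Sb.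
  apply: rt_trans Sb; apply: rt_step.
  apply: (@step_prod _ transduction_grammar [::] [::] None [::] (form q)).
  by rewrite mem_cat; apply/orP; left; apply/mapP; exists q; rewrite ?mem_enum.
Qed.

End Grammar.

Lemma indexed_transduction (L : language S) :
  indexed L -> indexed (transduction L).
Proof.
case=> G LG; exists (transduction_grammar G) => w.
rewrite generated_transduction.
by split=> -[u Lu Hu]; exists u => //; apply/LG.
Qed.

End Transduction.

Lemma eq_indexed (T : finType) (L L' : language T) :
  (forall w, L w <-> L' w) -> indexed L -> indexed L'.
Proof. by move=> LL' [G LG]; exists G => w; rewrite -LL'. Qed.

(** * The language of a group automaton as a transduction of the word problem *)

Section AutomatonTransducer.
Local Open Scope group_scope.
Variables (Sigma : finType) (G : groupType) (A : automaton Sigma G).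
Variables (S : {fset G}) (spell : G -> seq S).
Hypotheses (spellK : forall g, word_value (spell g) = g).
Hypotheses (spell_neq0 : forall g, spell g != [::]).

(** A common bound on the spellings of edge labels keeps the state set finite. *)
Definition spell_bound := \max_(e <- edges A) size (spell e.1.2.2).

(* The second component is what remains to be read of the spelling of the last
   edge taken. *)
Definition automaton_state : finType := (vertex A * spell_bound.-bseq S)%type.

(** With letters pending, a move reads the next one and writes nothing. With none pending, it takes
    an edge, writes its letter if any, and reads the first letter of its spelling; an edge spelled
    by the empty word could never be taken. *)
Definition automaton_transducer : transducer S (signed Sigma) :=
  @Transducer _ _ automaton_state
    (fun q s =>
      [seq ([::], q') | q' <- [seq q' : automaton_state <- enum automaton_state |
                  (q'.1 == q.1) && (q.2 == s :: q'.2 :> seq S)]] ++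
      [seq (seq_of_opt e.1.2.1, q') | e <- edges A,
         q' <- [seq q' : automaton_state <- enum automaton_state | [&& q.2 == [::] :> seq S,
                  e.1.1 == q.1, e.2 == q'.1 & spell e.1.2.2 == s :: q'.2]]])
    (start A, [bseq])
    [set q : automaton_state | (q.1 \in accept A) && (q.2 == [::] :> seq S)].

Lemma automaton_movesP (q q' : automaton_state) s m :
  (m, q') \in moves (t := automaton_transducer) q s <->
  [/\ m = [::], q'.1 = q.1 & q.2 = s :: q'.2 :> seq S] \/
  (exists2 e, e \in edges A & [/\ q.2 = [::] :> seq S, e.1.1 = q.1, e.2 = q'.1,
     spell e.1.2.2 = s :: q'.2 & m = seq_of_opt e.1.2.1]).
Proof.
rewrite mem_cat; split.
- case/orP.
    by case/mapP=> p; rewrite mem_filter => /andP [/andP [/eqP E1 /eqP E2] _]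
      [-> ->]; left.
  case/allpairsPdep=> e [p [He]]; rewrite mem_filter.
  case/andP=> /and4P [/eqP E1 /eqP E2 /eqP E3 /eqP E4] _ [-> ->].
  by right; exists e.
- case=> [[-> E1 E2] | [e He [E1 E2 E3 E4 ->]]]; apply/orP; [left|right].
    by apply/mapP; exists q'; rewrite // mem_filter E1 E2 !eqxx mem_enum.
  apply/allpairsPdep; exists e, q'; split=> //.
  by rewrite mem_filter E1 E2 E3 E4 !eqxx mem_enum.
Qed.

Lemma word_value_cons (s : S) u : word_value (s :: u) = fsval s * word_value u.
Proof. by rewrite /word_value big_cons. Qed.

Lemma word_value_cat (u v : seq S) :
  word_value (u ++ v) = word_value u * word_value v.
Proof. by rewrite /word_value big_cat. Qed.

Lemma path_word_cons e p :
  path_word (e :: p : seq (vertex A * _ * vertex A)) =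
  seq_of_opt e.1.2.1 ++ path_word p.
Proof. by rewrite /path_word /=; case: e.1.2.1. Qed.

(** The invariant carries the pending word [q.2] as a left factor: it is read before any new edge is
    taken, and none of it remains at [q']. *)
Lemma transduces_path u q w q' :
  transduces (M := automaton_transducer) u q w q' -> q'.2 = [::] :> seq S ->
  exists p, [/\ is_path q.1 p q'.1, path_word p = w &
    word_value u = word_value q.2 * path_value p].
Proof.
elim: u q w => [|s u IH] q w /=.
  case=> -> -> E; exists [::]; rewrite /= eqxx E.
  by rewrite /path_value /word_value !big_nil mulg1.
case=> -[m q1] [w' [/automaton_movesP Hm Hu ->]] Eq'.
have [p [Hp <- E]] := IH _ _ Hu Eq'.
case: Hm => [[-> Eq Es] | [e He [Eq E1 E2 E3 ->]]].
  exists p; rewrite -Eq; split=> //.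
  by rewrite word_value_cons E Es word_value_cons mulgA.
exists (e :: p); rewrite path_word_cons; split=> //=.
  by rewrite He E1 eqxx E2.
rewrite word_value_cons E mulgA -word_value_cons -E3 spellK Eq.
by rewrite /path_value big_cons /word_value big_nil mul1g.
Qed.

Lemma transduces_pending (r : seq S) u (q q' : automaton_state) w :
  transduces (M := automaton_transducer) u (q.1, [bseq]) w q' ->
  q.2 = r :> seq S ->
  transduces (M := automaton_transducer) (r ++ u) q w q'.
Proof.
move=> Hu; elim: r q Hu => [|s r IH] q Hu Er /=.
  suff <- : (q.1, [bseq]) = q by [].
  by case: q Er {Hu} => v b /= Eb; congr pair; apply: val_inj.
(* The remainder is shorter than the pending word, so it fits the same bound. *)
have Hr : (size r <= spell_bound)%N.
  by apply: ltnW; apply: leq_trans (size_bseq q.2); rewrite Er.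
exists ([::], (q.1, Bseq Hr)), w; split=> //; last exact: IH.
by apply/automaton_movesP; left.
Qed.

Lemma path_transduces p v v' :
  is_path v p v' ->
  exists2 u, transduces (M := automaton_transducer) u
               (v, [bseq]) (path_word p) (v', [bseq])
    & word_value u = path_value p.
Proof.
elim: p v => [|e p IH] v; rewrite [is_path _ _ _]/=.
  by move/eqP=> ->; exists [::]; rewrite // /word_value /path_value !big_nil.
case/and3P=> He /eqP <- /IH [u Hu Eu].
exists (spell e.1.2.2 ++ u); last first.
  by rewrite word_value_cat Eu spellK /path_value big_cons.
have : (size (spell e.1.2.2) <= spell_bound)%N.
  by rewrite /spell_bound (big_rem e) //= leq_maxl.
(* Nonemptiness gives the letter [s] on which the edge is taken; [r] becomes the pending word. *)
move: (spell_neq0 e.1.2.2); case Es: (spell _) => [|s r] // _ Hr.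
exists (seq_of_opt e.1.2.1, (e.2, Bseq (ltnW Hr))), (path_word p).
rewrite path_word_cons; split=> //; last exact: transduces_pending.
by apply/automaton_movesP; right; exists e.
Qed.

Lemma transduction_automaton w :
  transduction automaton_transducer (word_problem (S := S)) w <-> accepted A w.
Proof.
split.
- case=> u Hu [q]; rewrite inE => /andP [Hq /eqP Eq] /transduces_path.
  case=> // p [Hp <- E]; exists p, q.1 => //; split=> //.
  by rewrite -Hu E {1}/word_value big_nil mul1g.
- case=> p [v Hv [/path_transduces [u Hu Eu] <- Ep]]; exists u.
    by rewrite /word_problem Eu.
  by exists (v, [bseq]) => //; rewrite inE Hv /=.
Qed.

End AutomatonTransducer.

(** * Spellings in the generators, and the word problem as the language of an automaton *)

Section Groups.
Local Open Scope group_scope.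
Variables (G : groupType) (S : {fset G}).

(* Starting with [s0] keeps the spelling of the identity nonempty. *)
Lemma nonempty_spelling (s0 : S) : generates_as_monoid S ->
  exists2 spell : G -> seq S, forall g, word_value (spell g) = g
    & forall g, spell g != [::].
Proof.
move=> genS; have exw g : exists w : seq S, word_value w == g.
  by have [w <-] := genS g; exists w.
exists (fun g => s0 :: xchoose (exw ((fsval s0)^-1 * g))) => // g.
by rewrite word_value_cons (eqP (xchooseP (exw _))) mulVKg.
Qed.

Lemma indexed_accepted (Sigma : finType) (A : automaton Sigma G) (s0 : S) :
  generates_as_monoid S -> indexed (word_problem (S := S)) ->
  indexed (accepted A).
Proof.
move=> /(nonempty_spelling s0) [spell spellK spell_neq0] WP.
apply: eq_indexed (indexed_transduction (automaton_transducer A spell) WP) => w.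
exact: transduction_automaton.
Qed.

Definition word_problem_automaton : automaton S G :=
  @Automaton S G unit [seq (tt, (Some (inl s), fsval s), tt) | s : S] tt setT.

Lemma accepted_word_problem (w : seq (signed S)) :
  accepted word_problem_automaton w <->
  exists2 u, word_problem u & w = map inl u.
Proof.
split.
- case=> p [q _ [Hp <- Ep]]; suff [u Eu Wu] : exists2 u : seq S,
    word_value u = path_value p & path_word p = map inl u.
    by exists u => //; rewrite /word_problem Eu.
  elim: p (start _) Hp {Ep} => [|e p IH] v /=.
    by exists [::]; rewrite // /word_value /path_value !big_nil.
  case/andP=> /mapP [s _ ->] /IH [u Eu Wu]; exists (s :: u).
    by rewrite word_value_cons Eu /path_value big_cons.
  by rewrite /= -Wu.
- case=> u Hu ->.
  pose step_of s : vertex word_problem_automaton * (option (signed S) * G) *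
    vertex word_problem_automaton := (tt, (Some (inl s), fsval s), tt).
  exists (map step_of u), tt; rewrite ?inE //; split.
  + elim: u {Hu} => //= s u IH; rewrite IH andbT.
    by apply/mapP; exists s; rewrite // mem_enum.
  + by elim: u {Hu} => //= s u IH; rewrite -IH.
  + by rewrite /path_value big_map.
Qed.

(** Automata accept words over signed letters, so this returns to the alphabet [S]. The words it is
    applied to contain no formal inverses, and the value on [inr] is arbitrary. *)
Definition forget_sign : transducer (signed S) S :=
  @Transducer _ _ unit
    (fun _ x => [:: ([:: match x with inl s => s | inr s => s end], tt)])
    tt setT.

Lemma transduction_forget_sign w :
  transduction forget_sign (accepted word_problem_automaton) w <->
  word_problem w.
Proof.
have forgetP u v q q' :
    transduces (M := forget_sign) (map inl u) q v q' <-> u = v.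
  elim: u v q => [|s u IH] v q /=; first by case: q q' => -[]; split=> [[]|].
  split.
    by case=> m [v' [/[!inE] /eqP -> /IH -> ->]].
  move=> <-; exists ([:: s], tt), u; split; rewrite ?inE //.
  exact/IH.
split.
- by case=> _ /accepted_word_problem [u Hu ->] [q _ /forgetP <-].
- move=> Hw; exists (map inl w); first by apply/accepted_word_problem; exists w.
  by exists tt; [rewrite inE | apply/forgetP].
Qed.

End Groups.

(** For positive [n] there is a nonzero vector, here the all-ones one, and the empty product cannot
    represent it; so its spelling has a first letter. *)
Lemma Zn_generators_nonempty n (S : {fset Zn n}) :
  1 <= n -> generates_as_monoid S -> inhabited S.
Proof.
case: n S => // n S _ genS.
have [[|s w] Ew] := genS (const_mx 1%R : 'rV[int]_n.+1); last by split.
move: Ew; rewrite /word_value big_nil => /matrixP /(_ 0%R 0%R).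
by rewrite !mxE.
Qed.

Theorem corollary7 (gens : forall n : nat, {fset Zn n})
    (gensP : forall n : nat, 1 <= n -> generates_as_monoid (gens n)) :
  (forall n : nat, 1 <= n -> indexed (word_problem (S := gens n))) <->
  (forall (Sigma : finType) (L : language (signed Sigma)), counter L -> indexed L).
Proof.
split=> [WP Sigma L [k k_gt0 [A LA]] | counter_indexed n n_gt0].
- have [s0] := Zn_generators_nonempty k_gt0 (gensP k k_gt0).
  apply: (eq_indexed (L := accepted A)) => [w|]; first by rewrite LA.
  exact: indexed_accepted s0 (gensP k k_gt0) (WP k k_gt0).
(* The one-vertex automaton over [Zn n] makes its language [n]-counter, and forgetting signs turns
   that language into the word problem. *)
- apply: eq_indexed (@transduction_forget_sign _ (gens n)) _.
  apply: indexed_transduction; apply: counter_indexed.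
  by exists n => //; exists (word_problem_automaton (gens n)).
Qed.
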